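(* Let $G$ be a graph with $n$ vertices, $m$ edges, minimum degree $\delta$ and maximum degree $\Delta$. Then \[1 \leq \alpha_{ir}(G) \leq \min \left\{ \Delta - \delta +1, \, \left \lfloor \frac{n-\delta+1}{2} \right \rfloor , \, \frac{1+ \sqrt{2n^2-2n-4m+1}}{2} \right\}.\] Moreover, the bound is sharp: there exist graphs for which the lower bound holds with equality, and there exist graphs for which the upper bound holds with equality.
   Context: All graphs are finite, simple, undirected and have at least one vertex. An irregular independent set of a graph $G$ is an independent set $A$ of $G$ such that any two distinct vertices in $A$ have different degrees in $G$. The irregular independence number $\alpha_{ir}(G)$ is the size of a largest irregular independent set of $G$. *)

(* Defs.v *)
From HB Require Import structures.
From mathcomp Require Import all_boot all_order all_algebra.
From mathcomp Require Import reals.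

Set Implicit Arguments.
Unset Strict Implicit.
Unset Printing Implicit Defensive.

Import Order.TTheory GRing.Theory Num.Theory.

Record sgraph := SGraph {
  vertex :> finType;
  adj : rel vertex;
  adj_sym : symmetric adj;
  adj_irrefl : irreflexive adj;
  vertex_gt0 : (0 < #|vertex|)%N
}.

Section Graph.
Variable G : sgraph.
Implicit Types (x y : G) (A : {set G}).

Definition edges : {set {set G}} :=
  [set E : {set G} | [exists x : G, exists y : G, adj x y && (E == [set x; y])]].

Definition deg x : nat := #|[set y | adj x y]|.

Definition max_degree : nat := \max_(x : G) deg x.

(* Every degree is less than #|G| and G is nonempty, so the default value #|G|
   is never the result. *)
Definition min_degree : nat := \big[minn/#|G|]_(x : G) deg x.

Definition independent A : bool :=
  [forall x in A, forall y in A, ~~ adj x y].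

Definition irregular_independent A : bool :=
  independent A &&
  [forall x in A, forall y in A, (x != y) ==> (deg x != deg y)].

Definition alpha_ir : nat :=
  \max_(A : {set G} | irregular_independent A) #|A|.

End Graph.

Local Open Scope ring_scope.

Definition alpha_ir_upper (R : realType) (G : sgraph) : R :=
  let n : R := #|G|%:R in
  let m : R := #|edges G|%:R in
  let delta : R := (min_degree G)%:R in
  let Delta : R := (max_degree G)%:R in
  Num.min (Delta - delta + 1)
    (Num.min (Num.floor ((n - delta + 1) / 2))%:~R
       ((1 + Num.sqrt (2 * n ^+ 2 - 2 * n - 4 * m + 1)) / 2)).

(* Main.v *)
Require Import Defs.
From mathcomp Require Import all_boot all_order all_algebra.
From mathcomp Require Import reals.
From mathcomp Require Import zify lra.

Import Order.TTheory GRing.Theory Num.Theory.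

(** Let [A] be an irregular independent set with [k] elements. Its degrees are
    [k] distinct naturals between [delta] and [min Delta (n - k)], because the
    neighbours of a vertex of [A] lie outside [A]; this gives the first two
    bounds. For the third, the numbers [n - k - deg x], [x] in [A], are distinct
    naturals, so [A] misses at least [k (k - 1) / 2] of the [k (n - k)] possible
    edges to its complement, besides the [k (k - 1) / 2] pairs inside [A]. Hence
    [m <= n (n - 1) / 2 - k (k - 1)], which is solved for [k]. The graph with a
    single vertex attains both the lower and the upper bound. *)

Lemma card_inj_in_range (T : finType) (A : {set T}) (f : T -> nat) (a b : nat) :
  {in A &, injective f} -> (forall x, x \in A -> a <= f x <= b) ->
  #|A| <= b.+1 - a.
Proof.
move=> f_inj f_range.
have /card_in_imset <- : {in A &, injective (fun x => inord (f x - a) : 'I_(b - a).+1)}.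
  move=> x y xA yA /(congr1 val) /=.
  have := f_range x xA; have := f_range y yA => ? ?.
  rewrite !inordK; [move=> ?; apply: f_inj => //; lia | lia | lia].
(* If [A] is empty, [b < a] is possible and [b.+1 - a] may be [0], whereas ['I_(b - a).+1] always
   has an element. *)
case: (set_0Vmem A) => [->|[x /f_range ?]]; first by rewrite imset0 cards0.
by rewrite (leq_trans (max_card _)) // card_ord; lia.
Qed.

(** Induction on the size [k] of [A], removing an [x] that maximizes [f]. The other [k - 1] values
    are distinct and below [f x], so [f x >= k - 1], and Pascal's rule adds exactly this amount. *)
Lemma bin2_leq_sum_inj (T : finType) (A : {set T}) (f : T -> nat) :
  {in A &, injective f} -> 'C(#|A|, 2) <= \sum_(x in A) f x.
Proof.
elim: {A}_.+1 {-2}A (ltnSn #|A|) => // N IH A; rewrite ltnS => cardA f_inj.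
have [->|[x0 x0A]] := set_0Vmem A; first by rewrite cards0.
case: (arg_maxnP f x0A) => x xA /= x_max.
have f_injD : {in A :\ x &, injective f}.
  by move=> y z /setD1P[_ yA] /setD1P[_ zA]; apply: f_inj.
have cardE := cardsD1 x A; rewrite (xA : x \in A) add1n in cardE.
have cardD : #|A :\ x| <= f x.
  have [->|[y0 /setD1P[y0x y0A]]] := set_0Vmem (A :\ x); first by rewrite cards0.
  have lt_x y : y \in A :\ x -> f y < f x.
    move=> /setD1P[yx yA]; rewrite ltn_neqAle; apply/andP; split; last exact: x_max.
    by apply: contra yx => /eqP /f_inj ->.
  (* Positivity makes [(f x).-1] a genuine upper end of the range of [f] on [A :\ x]. *)
  have fx_gt0 : 0 < f x.
    by apply: leq_trans (lt_x y0 _); rewrite // !inE y0x.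
  rewrite -(prednK fx_gt0) -[_.-1.+1]subn0.
  apply: card_inj_in_range f_injD _ => y /lt_x; lia.
have := IH (A :\ x); rewrite -cardE => /(_ cardA f_injD) IHx.
by rewrite (big_setD1 x) //= cardE binS bin1 addnC leq_add.
Qed.

Section IrregularIndependent.
Variable G : sgraph.
Implicit Types (x y : G) (A : {set G}).

Lemma deg_sum x : deg x = \sum_y adj x y.
Proof.
rewrite /deg cardsE -sum1_card big_mkcond; apply: eq_bigr => y _ /=.
by rewrite -topredE /=; case: (adj x y).
Qed.

Lemma min_degree_leq x : min_degree G <= deg x.
Proof.
rewrite /min_degree; have := mem_index_enum x.
elim: index_enum => // y s IH; rewrite inE big_cons geq_min.
by case/orP=> [/eqP <-|/IH ->]; rewrite ?leqnn ?orbT.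
Qed.

Lemma max_degree_geq x : deg x <= max_degree G.
Proof. exact: leq_bigmax. Qed.

(** One direction of the handshake identity. Ordered pairs [(x, y)] are grouped by the set
    [[set x; y]]; the group of an edge contains two distinct adjacent pairs, [(x, y)] and
    [(y, x)]. *)
Lemma double_edges_leq : 2 * #|edges G| <= \sum_(x : G) deg x.
Proof.
under eq_bigr do rewrite deg_sum.
rewrite pair_big /= mulnC -sum_nat_const.
rewrite (bigID (fun p : G * G => [set p.1; p.2] \in edges G)) /=.
apply: leq_trans (leq_addr _ _).
rewrite (partition_big (fun p : G * G => [set p.1; p.2]) (mem (edges G))) //=.
apply: leq_sum => E EG; move: (EG); rewrite inE.
move=> /existsP[x /existsP[y /andP[xy /eqP defE]]].
have nxy : x != y by apply: contraL xy => /eqP ->; rewrite adj_irrefl.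
rewrite (bigD1 (x, y)) /=; last by rewrite -defE EG eqxx.
rewrite (bigD1 (y, x)) /=; last by rewrite setUC -defE EG eqxx xpair_eqE negb_and eq_sym nxy.
by rewrite xy adj_sym xy.
Qed.

Variable A : {set G}.
Hypothesis irrA : irregular_independent A.

Lemma irregular_nonadj x y : x \in A -> y \in A -> adj x y = false.
Proof.
case/andP: irrA => /forall_inP indA _ xA yA.
by apply/negbTE; move/forall_inP: (indA x xA); apply.
Qed.

Lemma irregular_deg_inj : {in A &, injective (@deg G)}.
Proof.
case/andP: irrA => _ /forall_inP degA x y xA yA eq_deg; apply/eqP.
by have /forall_inP/(_ y yA) := degA x xA; rewrite eq_deg eqxx implybF negbK.
Qed.

Lemma irregular_deg_leq x : x \in A -> deg x <= #|~: A|.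
Proof.
move=> xA; apply/subset_leq_card/subsetP => y; rewrite !inE => xy.
by apply: contraL xy => yA; rewrite irregular_nonadj.
Qed.

Lemma irregular_card_degree_range : #|A| <= (max_degree G).+1 - min_degree G.
Proof.
apply: card_inj_in_range irregular_deg_inj _ => x _.
by rewrite min_degree_leq max_degree_geq.
Qed.

(** Since [#|~: A|] is [n - k], this amounts to [2 k <= n - delta + 1] for nonempty [A]. *)
Lemma irregular_card_half : #|A| <= #|~: A|.+1 - min_degree G.
Proof.
apply: card_inj_in_range irregular_deg_inj _ => x xA.
by rewrite min_degree_leq irregular_deg_leq.
Qed.

Lemma irregular_sum_deg :
  \sum_(x in A) deg x + 'C(#|A|, 2) <= #|A| * #|~: A|.
Proof.
have codeg_inj : {in A &, injective (fun x => #|~: A| - deg x)}.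
  (* The truncated subtraction is injective here because degrees in [A] are at most [#|~: A|]. *)
  move=> x y xA yA /= eq_codeg; apply: irregular_deg_inj => //.
  have := irregular_deg_leq x xA; have := irregular_deg_leq y yA; lia.
apply: leq_trans (leq_add (leqnn _) (bin2_leq_sum_inj _ _ _ codeg_inj)) _.
rewrite -big_split -sum_nat_const /=.
by apply/leq_sum => x xA; rewrite subnKC // irregular_deg_leq.
Qed.

(** Edges between [A] and its complement, counted from the side of [A], number at most the degree
    sum of [A]; inside the complement a vertex has at most [#|~: A| - 1] neighbours. *)
Lemma sum_deg_setC :
  \sum_(x in ~: A) deg x <= \sum_(x in A) deg x + #|~: A| * #|~: A|.-1.
Proof.
have -> : \sum_(x in ~: A) deg x =
    \sum_(x in ~: A) \sum_(y in A) adj x y +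
    \sum_(x in ~: A) \sum_(y in ~: A) adj x y.
  rewrite -big_split; apply: eq_bigr => x _.
  rewrite deg_sum (bigID (mem A)) /=; congr (_ + _).
  by apply: eq_bigl => y; rewrite inE.
rewrite leq_add //.
  rewrite exchange_big /=; apply: leq_sum => y yA.
  rewrite deg_sum [leqRHS](bigID (mem (~: A))) /=; apply: leq_trans (leq_addr _ _).
  by apply: leq_sum => x _; rewrite adj_sym.
rewrite -sum_nat_const; apply: leq_sum => x xA.
have -> : #|~: A|.-1 = #|(~: A) :\ x| by rewrite (cardsD1 x) xA.
rewrite (big_setD1 x) //= adj_irrefl add0n -sum1_card.
by apply: leq_sum => y _; case: (adj x y).
Qed.

(** This is [2 m <= n (n - 1) - 2 k (k - 1)] without subtraction. With [c = n - k] and [D] the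
    degree sum of [A], it combines [2 m <= 2 D + c (c - 1)] and [D <= k c - k (k - 1) / 2]. *)
Lemma irregular_card_edges :
  2 * #|edges G| + 2 * (#|A| * #|A|) + #|G| <= #|G| * #|G| + 2 * #|A|.
Proof.
have le_m := double_edges_leq; have le_A := irregular_sum_deg; have le_C := sum_deg_setC.
have cardG := cardsC A.
rewrite (bigID (mem A)) /= in le_m.
rewrite [X in _ + X](eq_bigl (fun x => x \in ~: A)) /= in le_m;
  last by move=> x; rewrite inE.
have bin2E : 2 * 'C(#|A|, 2) = #|A| * #|A|.-1
  by rewrite -mul_bin_diag bin1.
move: le_m le_A le_C bin2E; rewrite -cardG.
move: (\sum_(x in A) _) (\sum_(x in ~: A) _) ('C(_, _)) #|edges G| => D D' B m.
move: #|A| #|~: A| => [|k] [|c] /=; nia.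
Qed.

End IrregularIndependent.

Lemma alpha_ir_gt0 (G : sgraph) : 0 < alpha_ir G.
Proof.
have /card_gt0P[x _] := vertex_gt0 G.
have irr1 : irregular_independent [set x].
  apply/andP; split; apply/forall_inP => y /set1P ->; apply/forall_inP => z /set1P ->.
    by rewrite adj_irrefl.
  by rewrite eqxx.
by rewrite -(cards1 x); apply: leq_bigmax_cond.
Qed.

Lemma alpha_ir_attained (G : sgraph) :
  exists2 A : {set G}, irregular_independent A & alpha_ir G = #|A|.
Proof.
have irr_gt0 : 0 < #|[pred A : {set G} | irregular_independent A]|.
  apply/card_gt0P; exists set0; rewrite inE.
  by apply/andP; split; apply/forall_inP => x; rewrite inE.
by have [A irrA alphaE] := eq_bigmax_cond (fun A : {set G} => #|A|) irr_gt0; exists A.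
Qed.

Local Open Scope ring_scope.

Lemma alpha_ir_leq_upper (R : realType) (G : sgraph) :
  (alpha_ir G)%:R <= alpha_ir_upper R G.
Proof.
have [A irrA alphaE] := alpha_ir_attained G.
have := alpha_ir_gt0 G; rewrite alphaE => k_gt0.
have leDelta := irregular_card_degree_range G A irrA.
have leHalf := irregular_card_half G A irrA.
have leEdges := irregular_card_edges G A irrA.
have cardG := cardsC A.
rewrite /alpha_ir_upper !le_min; apply/and3P; split.
(* As [#|A| > 0], the truncated differences in [leDelta] and [leHalf] are genuine. *)
- have : (#|A| + min_degree G <= max_degree G + 1)%N by lia.
  by rewrite -(ler_nat R) !natrD; lra.
- rewrite -[#|A|%:R]/((#|A|%:Z)%:~R) ler_int floor_ge_int.
  have : (2 * #|A| + min_degree G <= #|G| + 1)%N by lia.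
  by rewrite -(ler_nat R) natrD natrM natrD -pmulrn; lra.
- have k_ge1 : 1 <= #|A|%:R :> R by rewrite ler1n.
  (* The edge bound, doubled, says that [(2 k - 1) ^ 2] is at most the radicand, and [2 k - 1] is
     nonnegative. *)
  have : 2 * #|A|%:R - 1 <=
      Num.sqrt (2 * #|G|%:R ^+ 2 - 2 * #|G|%:R - 4 * #|edges G|%:R + 1) :> R.
    rewrite -[leLHS]ger0_norm -?sqrtr_sqr; last by lra.
    apply: ler_wsqrtr.
    by move: leEdges; rewrite -(ler_nat R) !natrD !natrM; lra.
  by lra.
Qed.

Lemma one_vertex_sym : symmetric (fun _ _ : unit => false). Proof. by []. Qed.
Lemma one_vertex_irrefl : irreflexive (fun _ : unit => xpred0 : pred unit). Proof. by []. Qed.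
Lemma one_vertex_gt0 : (0 < #|{: unit}|)%N. Proof. by rewrite card_unit. Qed.

Definition one_vertex : sgraph :=
  SGraph one_vertex_sym one_vertex_irrefl one_vertex_gt0.

Lemma alpha_ir_one_vertex : alpha_ir one_vertex = 1%N.
Proof.
apply/eqP; rewrite eqn_leq alpha_ir_gt0 andbT.
by apply/bigmax_leqP => A _; rewrite -card_unit max_card.
Qed.

(** The first term of the minimum suffices: with [Delta = 0] it is [1 - delta], at most [1] whatever
    [delta] is. *)
Lemma alpha_ir_upper_one_vertex (R : realType) : alpha_ir_upper R one_vertex <= 1.
Proof.
have Delta0 : max_degree one_vertex = 0%N.
  by apply: big1 => x _; rewrite deg_sum big1.
by rewrite /alpha_ir_upper ge_min Delta0 sub0r gerDr oppr_le0 ler0n.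
Qed.

Theorem theorem2p1 (R : realType) :
  (forall G : sgraph,
     (1 <= alpha_ir G)%N /\ (alpha_ir G)%:R <= alpha_ir_upper R G) /\
  (exists G : sgraph, alpha_ir G = 1%N) /\
  (exists G : sgraph, (alpha_ir G)%:R = alpha_ir_upper R G).
Proof.
split; first by move=> G; split; [exact: alpha_ir_gt0 | exact: alpha_ir_leq_upper].
split; exists one_vertex; first exact: alpha_ir_one_vertex.
apply: le_anti; rewrite alpha_ir_leq_upper /=.
by rewrite alpha_ir_one_vertex alpha_ir_upper_one_vertex.
Qed.
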